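(* Every o-minimal trace has no external limits.
   Context: ''Definable'' means definable with parameters. A structure $\mathcal M=\langle M,<,\dots\rangle$ is weakly o-minimal if $<$ is a dense linear order and every definable subset of $M$ is a finite union of convex sets. A structure $\mathcal M$ is an o-minimal trace if there exists an o-minimal expansion $\mathcal N_0$ of an ordered group, in a language $\mathcal L_0$, such that $M\subsetneq N_0$ is dense in $N_0$, $\mathcal M|\mathcal L_0\prec\mathcal N_0$, and $\mathcal M$ is the structure induced on $M$ from $\mathcal N_0$; that is (up to a change of signature), $\mathcal M$ is $\mathcal M|\mathcal L_0$ expanded by all sets $D\cap M^n$ with $D\subseteq N_0^n$ definable (with parameters) in $\mathcal N_0$. O-minimal traces are weakly o-minimal. A weakly o-minimal structure $\mathcal M$ has no external limits if for every definable $f:(a,b)\to M$, where $a,b\in M\cup\{\pm\infty\}$, the limits $\lim_{t\to a^+}f(t)$ and $\lim_{t\to b^-}f(t)$ exist in $M\cup\{\pm\infty\}$. *)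

(* Defs.v *)
From mathcomp Require Import all_boot.

Set Implicit Arguments.
Unset Strict Implicit.
Unset Printing Implicit Defensive.

Record language := Language {
  fsym : nat -> Type;
  rsym : nat -> Type }.

Record olanguage := OLanguage {
  olang :> language;
  lt_sym : rsym olang 2 }.

Record structure (L : language) (T : Type) := Structure {
  fint : forall k, fsym L k -> ('I_k -> T) -> T;
  rint : forall k, rsym L k -> ('I_k -> T) -> Prop }.

Inductive term (L : language) (n : nat) : Type :=
| Var of 'I_n
| App k of fsym L k & ('I_k -> term L n).

(* Formulas with free variables among n; FAll binds variable ord0.  The
   semantics is classical, so the omitted connectives are abbreviations. *)
Inductive formula (L : language) : nat -> Type :=
| FBot n : formula L n
| FEq n : term L n -> term L n -> formula L n
| FRel n k : rsym L k -> ('I_k -> term L n) -> formula L n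
| FImp n : formula L n -> formula L n -> formula L n
| FAll n : formula L n.+1 -> formula L n.

Definition fcons (T : Type) n (a : T) (e : 'I_n -> T) : 'I_n.+1 -> T :=
  fun i => if unlift ord0 i is Some j then e j else a.

Definition fcat (T : Type) n k (x : 'I_n -> T) (c : 'I_k -> T) :
    'I_(n + k) -> T :=
  fun i => match split i with inl j => x j | inr j => c j end.

Definition pair2 (T : Type) (x y : T) : 'I_2 -> T :=
  fun i => if i == ord0 then x else y.

Fixpoint eval L T (M : structure L T) n (e : 'I_n -> T) (t : term L n) : T :=
  match t with
  | Var i => e i
  | App _ f ts => fint M f (fun j => eval M e (ts j))
  end.

Fixpoint sat L T (M : structure L T) n (phi : formula L n) :
    ('I_n -> T) -> Prop :=
  match phi in formula _ m return ('I_m -> T) -> Prop with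
  | FBot _ => fun _ => False
  | FEq _ s t => fun e => eval M e s = eval M e t
  | FRel _ _ r ts => fun e => rint M r (fun j => eval M e (ts j))
  | FImp _ p q => fun e => sat M p e -> sat M q e
  | FAll _ p => fun e => forall a, sat M p (fcons a e)
  end.

Definition definable0 L T (M : structure L T) n (X : ('I_n -> T) -> Prop) :=
  exists phi : formula L n, forall x, X x <-> sat M phi x.

(* Definable with parameters. *)
Definition definable L T (M : structure L T) n (X : ('I_n -> T) -> Prop) :=
  exists k (phi : formula L (n + k)) (c : 'I_k -> T),
    forall x, X x <-> sat M phi (fcat x c).

Definition definable1 L T (M : structure L T) (X : T -> Prop) :=
  definable M (fun x : 'I_1 -> T => X (x ord0)).

Definition definable2 L T (M : structure L T) (R : T -> T -> Prop) :=
  definable M (fun x : 'I_2 -> T => R (x ord0) (x ord_max)).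

Definition elementary_embedding L T U (M : structure L T) (N : structure L U)
    (iota : T -> U) :=
  forall n (phi : formula L n) (x : 'I_n -> T),
    sat M phi x <-> sat N phi (iota \o x).

(* Definitional equivalence: equality up to a change of signature. *)
Definition interdefinable L1 L2 T (M1 : structure L1 T) (M2 : structure L2 T) :=
  forall n (X : ('I_n -> T) -> Prop), definable0 M1 X <-> definable0 M2 X.

Definition slt (L : olanguage) T (M : structure L T) (x y : T) : Prop :=
  rint M (lt_sym L) (pair2 x y).

Definition dense_linear_order T (lt : T -> T -> Prop) :=
  [/\ forall x, ~ lt x x,
      forall x y z, lt x y -> lt y z -> lt x z,
      forall x y, [\/ lt x y, x = y | lt y x]
    & forall x y, lt x y -> exists z, lt x z /\ lt z y].

(* T together with endpoints -oo and +oo. *)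
Inductive ext (T : Type) := NInf | Fin of T | PInf.
Arguments NInf {T}.
Arguments PInf {T}.

Definition ext_lt T (lt : T -> T -> Prop) (a b : ext T) : Prop :=
  match a, b with
  | NInf, NInf => False
  | NInf, _ => True
  | Fin x, Fin y => lt x y
  | Fin _, PInf => True
  | _, _ => False
  end.

Definition itv T (lt : T -> T -> Prop) (a b : ext T) (x : T) : Prop :=
  ext_lt lt a (Fin x) /\ ext_lt lt (Fin x) b.

Definition point_or_interval T (lt : T -> T -> Prop) (A : T -> Prop) :=
  (exists p, forall x, A x <-> x = p) \/
  (exists a b, forall x, A x <-> itv lt a b x).

Definition o_minimal (L : olanguage) T (M : structure L T) :=
  dense_linear_order (slt M) /\
  forall X : T -> Prop, definable1 M X ->
    exists m (A : 'I_m -> T -> Prop),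
      (forall i, point_or_interval (slt M) (A i)) /\
      (forall x, X x <-> exists i, A i x).

(* A group, not assumed commutative, with a bi-invariant linear order. *)
Definition ordered_group T (lt : T -> T -> Prop) (add : T -> T -> T) :=
  [/\ [/\ forall x, ~ lt x x,
          forall x y z, lt x y -> lt y z -> lt x z
        & forall x y, [\/ lt x y, x = y | lt y x]],
      forall x y z, add x (add y z) = add (add x y) z,
      exists zero, (forall x, add zero x = x /\ add x zero = x) /\
        (forall x, exists y, add x y = zero /\ add y x = zero)
    & forall x y z, lt x y -> lt (add z x) (add z y) /\ lt (add x z) (add y z)].

Definition expands_ordered_group (L : olanguage) T (M : structure L T) :=
  exists add_sym : fsym L 2,
    ordered_group (slt M) (fun x y => fint M add_sym (pair2 x y)).

Definition trace_language (L : language) U (N : structure L U) : language :=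
  Language (fsym L)
    (fun k => (rsym L k + {D : ('I_k -> U) -> Prop | definable N D})%type).

(* M0 expanded by the trace of every set definable with parameters in N. *)
Definition induced_structure (L : language) T U (M0 : structure L T)
    (N : structure L U) (iota : T -> U) : structure (trace_language N) T :=
  @Structure (trace_language N) T
    (fun k (f : fsym L k) => fint M0 f)
    (fun k (r : rsym (trace_language N) k) (x : 'I_k -> T) =>
       match r with
       | inl r0 => rint M0 r0 x
       | inr D => sval D (iota \o x)
       end).

(* The inclusion of M in N is the elementary, hence injective, map iota, and
   M0 is the reduct of M to the language L0 of N. *)
Definition o_minimal_trace (L : olanguage) T (M : structure L T) :=
  exists (L0 : olanguage) (U : Type) (N : structure L0 U)
         (M0 : structure L0 T) (iota : T -> U),
    [/\ o_minimal N /\ expands_ordered_group N,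
        elementary_embedding M0 N iota,
        exists u, forall x, iota x <> u,
        forall u v, slt N u v -> exists x, slt N u (iota x) /\ slt N (iota x) v
      & (forall x y, slt M x y <-> slt M0 x y) /\
        interdefinable M (induced_structure M0 N iota)].

(* Limits of f at the endpoints of the interval (a, b), in the order topology
   of T with -oo and +oo added. *)
Definition right_limit T (lt : T -> T -> Prop) (a b : ext T) (f : T -> T)
    (l : ext T) :=
  forall c d, ext_lt lt c l \/ c = NInf -> ext_lt lt l d \/ d = PInf ->
    exists u, ext_lt lt a u /\ forall t, itv lt a u t -> itv lt a b t ->
      itv lt c d (f t).

Definition left_limit T (lt : T -> T -> Prop) (a b : ext T) (f : T -> T)
    (l : ext T) :=
  forall c d, ext_lt lt c l \/ c = NInf -> ext_lt lt l d \/ d = PInf ->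
    exists u, ext_lt lt u b /\ forall t, itv lt u b t -> itv lt a b t ->
      itv lt c d (f t).

(* f is a function on (a, b); its values elsewhere play no role. *)
Definition no_external_limits (L : olanguage) T (M : structure L T) :=
  forall (a b : ext T) (f : T -> T),
    ext_lt (slt M) a b ->
    definable2 M (fun x y => itv (slt M) a b x /\ y = f x) ->
    (exists l, right_limit (slt M) a b f l) /\
    (exists l, left_limit (slt M) a b f l).

(* Main.v *)
From mathcomp Require Import all_boot.
From Stdlib Require Import Setoid Classical FunctionalExtensionality PropExtensionality.
Require Import Defs.

(** Let M be the trace on T of the o-minimal structure N on U, so that T is a
dense elementary substructure of U.  The idea is that parameters from U can be
made generic over T, and that what holds at a generic tuple holds on a whole
box around it; density then lets points of T replace the parameters.

Call a tuple [c] of U generic over T when every T-definable set that contains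
[c] contains a box around [c] with endpoints in T.  Every tuple is definable
over T from a generic one ([generic_parameters]).  Indeed, let [c] be generic
and let [d] be a further element.  If [d] is not definable over [T, c], then
o-minimality puts [d] in the interior of every [T, c]-definable subset of U that
contains it, and by density in an interval [(p, q)] of such a subset with [p, q]
in T.  Containing [(p, q)] is then a T-definable property of [c], so it holds on
a box around [c]; hence [(c, d)] is generic ([generic_cons]).

So every definable subset of U is [D(-, c)] with [D] definable over T and [c]
generic, and for a point [x] of T, [D(x, c)] holds iff [D(x, z)] holds for all
[z] near [c].  Two consequences prove the theorem.

- Every set definable in M is the trace of a set definable in N
  ([induced_quantifier_elimination]).  The point is that there is [y] in T with
  [D(x, y, c)] iff there is [y] in U such that [D(x, y, z)] for all [z] near [c]:
  the box around [c] can be given endpoints in T, and then elementarity moves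
  [y] into T ([trace_projection]).

- Let the graph of [f] be the trace of [D(t, y, c)], and let [E(t, y, z)] say
  that [D(t, y, -)] holds near [z].  For [t] in T, [f t] is the only [y] in U
  with [E(t, y, c)].  By o-minimality there is [s] in T such that [E(u, -, c)]
  is a single point for all [u] in [(a, s)], and by genericity the same holds
  for [E(u, -, z)] with [z] in a box B around [c].  As a function of [z] in B
  that point is locally constant, hence constant.  So near [a] the function [f]
  is given by [exists z in B, E(t, y, z)], a formula over T.  Its limit
  at [a] exists in N by o-minimality, and by elementarity it is infinite or in T
  ([right_limit_exists]).

Limits from the left are limits from the right for the reversed order, and all
that is used of the order survives reversal. *)

(** * Renaming of variables *)

Section Renaming.
Set Implicit Arguments.
Unset Strict Implicit.

Lemma fcons0 (A : Type) n (a : A) (e : 'I_n -> A) : fcons a e ord0 = a.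
Proof. by rewrite /fcons unlift_none. Qed.

Lemma fcons_lift (A : Type) n (a : A) (e : 'I_n -> A) i :
  fcons a e (lift ord0 i) = e i.
Proof. by rewrite /fcons liftK. Qed.

Lemma fcons_map (A B : Type) (g : A -> B) n (a : A) (e : 'I_n -> A) i :
  fcons (g a) (fun j => g (e j)) i = g (fcons a e i).
Proof. by rewrite /fcons; case: unlift. Qed.

Lemma fcons_eta (A : Type) n (z : 'I_n.+1 -> A) :
  fcons (z ord0) (fun i => z (lift ord0 i)) = z.
Proof.
apply: functional_extensionality => i.
by case: (unliftP ord0 i) => [j ->|->]; rewrite ?fcons_lift ?fcons0.
Qed.

Fixpoint term_rename (L : language) n m (r : 'I_n -> 'I_m) (t : term L n) :
    term L m :=
  match t with
  | Var i => Var L (r i)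
  | App _ f ts => App f (fun j => term_rename r (ts j))
  end.

Fixpoint rename (L : language) n (phi : formula L n) :
    forall m, ('I_n -> 'I_m) -> formula L m :=
  match phi in formula _ n return forall m, ('I_n -> 'I_m) -> formula L m with
  | FBot _ => fun m _ => FBot L m
  | FEq _ s t => fun m r => FEq (term_rename r s) (term_rename r t)
  | FRel _ _ R ts => fun m r => FRel R (fun j => term_rename r (ts j))
  | FImp _ p q => fun m r => FImp (rename p r) (rename q r)
  | FAll _ p => fun m r => FAll (rename p (fcons ord0 (fun i => lift ord0 (r i))))
  end.

Lemma eval_rename L U (N : structure L U) n m (r : 'I_n -> 'I_m) e t :
  eval N e (term_rename r t) = eval N (fun i => e (r i)) t.
Proof.
elim: t => [//|k f ts IH] /=; congr (fint N f _).
exact: functional_extensionality.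
Qed.

Lemma sat_rename L U (N : structure L U) n (phi : formula L n) :
  forall m (r : 'I_n -> 'I_m) e,
    sat N (rename phi r) e <-> sat N phi (fun i => e (r i)).
Proof.
elim: n / phi => [n|n s t|n k R ts|n p IHp q IHq|n p IHp] m r e //=.
- by rewrite !eval_rename.
- suff -> : (fun j => eval N e (term_rename r (ts j))) =
            (fun j => eval N (fun i => e (r i)) (ts j)) by [].
  by apply: functional_extensionality => j; rewrite eval_rename.
- by rewrite IHp IHq.
- have E a : (fun i => fcons a e (fcons ord0 (fun i => lift ord0 (r i)) i)) =
             fcons a (fun i => e (r i)).
    apply: functional_extensionality => i; rewrite -(fcons_map (fcons a e)) fcons0.
    by congr (fcons _ _ i); apply: functional_extensionality => j; rewrite fcons_lift.
  by split=> H a; move: (H a); rewrite IHp E.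
Qed.

End Renaming.

(** * Definable predicates on environments *)

Section Definability.
Set Implicit Arguments.
Unset Strict Implicit.
Variables (L : language) (U : Type) (N : structure L U).

Definition lookup (K I : Type) (cst : K -> U) (e : I -> U) (a : I + K) : U :=
  match a with inl i => e i | inr k => cst k end.

(** Environments are indexed by an arbitrary type [I], so that predicates on
tuples, pairs and single elements are treated alike; constants are named by a
type [K].  For [cst = id] this is definability with parameters in the whole
structure, and for the inclusion of a substructure it is definability over that
substructure. *)
Definition defin (K : Type) (cst : K -> U) (I : Type) (P : (I -> U) -> Prop) :=
  exists n (phi : formula L n) (s : 'I_n -> I + K),
    forall e, P e <-> sat N phi (fun i => lookup cst e (s i)).

Definition ocons (I : Type) (u : U) (e : I -> U) (i : option I) : U :=
  if i is Some j then e j else u.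

Section Rules.
(* [k0] fills the slots of variables that a quantifier has bound. *)
Variables (K : Type) (cst : K -> U) (k0 : K).

Local Notation def := (defin cst).

Lemma defin_ext I (P Q : (I -> U) -> Prop) :
  (forall e, P e <-> Q e) -> def P -> def Q.
Proof. by move=> PQ [n [phi [s H]]]; exists n, phi, s => e; rewrite -PQ. Qed.

Lemma defin_subst I J (g : I -> J + K) (P : (I -> U) -> Prop) :
  def P -> def (fun e : J -> U => P (fun i => lookup cst e (g i))).
Proof.
move=> [n [phi [s H]]].
exists n, phi, (fun i => match s i with inl i => g i | inr k => inr k end) => e.
rewrite H; set a := (fun i => _); set b := (fun i => _).
suff -> : a = b by [].
by apply: functional_extensionality => i; rewrite /a /b; case: (s i).
Qed.

(** The side condition spares the users of [defin_subst] an appeal to functional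
extensionality whenever the environment is built by cases. *)
Lemma defin_app I J (g : I -> J + K) (P : (I -> U) -> Prop)
    (a : (J -> U) -> I -> U) :
  def P -> (forall e i, a e i = lookup cst e (g i)) -> def (fun e => P (a e)).
Proof.
move=> dP aE; apply: defin_ext (defin_subst g dP) => e.
suff -> : a e = (fun i => lookup cst e (g i)) by [].
by apply: functional_extensionality => i; apply: aE.
Qed.

Definition defin2 I k (D : (I -> U) -> ('I_k -> U) -> Prop) :=
  def (fun e : (I + 'I_k)%type -> U =>
         D (fun i => e (inl i)) (fun j => e (inr j))).

Lemma defin2_app I J k (g : I -> J + K) (h : 'I_k -> J + K)
    (D : (I -> U) -> ('I_k -> U) -> Prop) a b :
  defin2 D -> (forall e i, a e i = lookup cst e (g i)) ->
  (forall e j, b e j = lookup cst e (h j)) -> def (fun e => D (a e) (b e)).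
Proof.
move=> dD aE bE.
pose gh x := match x with inl i => g i | inr j => h j end.
pose ab e x := match x with inl i => a e i | inr j => b e j end.
by apply: (defin_app (g := gh) (a := ab) dD) => e [i|j] /=.
Qed.

Lemma defin_imp I (P Q : (I -> U) -> Prop) :
  def P -> def Q -> def (fun e => P e -> Q e).
Proof.
move=> [n [phi [s H]]] [m [psi [r G]]].
exists (n + m)%N, (FImp (rename phi (@lshift n m)) (rename psi (@rshift n m))).
exists (fun i => match split i with inl j => s j | inr j => r j end) => e /=.
rewrite !sat_rename H G.
set a := (fun i => _); set b := (fun i => _).
set a' := (fun i => _); set b' := (fun i => _).
suff [-> ->] : a = a' /\ b = b' by [].
split; apply: functional_extensionality => i; rewrite /a /a' /b /b'.
  by rewrite (unsplitK (inl i)).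
by rewrite (unsplitK (inr i)).
Qed.

Lemma defin_bot I : def (fun _ : I -> U => False).
Proof. by exists 0, (FBot L 0), (fun=> inr k0). Qed.

Lemma defin_all I (P : U -> (I -> U) -> Prop) :
  def (fun e : option I -> U => P (e None) (fun i => e (Some i))) ->
  def (fun e => forall u, P u e).
Proof.
move=> [n [phi [s H]]].
pose r (i : 'I_n) : 'I_n.+1 := if s i is inl None then ord0 else lift ord0 i.
pose s' (i : 'I_n) : I + K :=
  match s i with inl (Some j) => inl j | inl None => inr k0 | inr k => inr k end.
exists n, (FAll (rename phi r)), s' => e /=.
suff E u : P u e <-> sat N (rename phi r) (fcons u (fun i => lookup cst e (s' i))).
  by split=> HH u; apply/E.
rewrite sat_rename (H (ocons u e)) /=.
set a := (fun i => _); set b := (fun i => _).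
suff -> : a = b by [].
apply: functional_extensionality => i; rewrite /a /b /r /s'.
by case E: (s i) => [[j|]|k]; rewrite ?fcons0 ?fcons_lift ?E.
Qed.

Lemma defin_eq I (i j : I + K) :
  def (fun e : I -> U => lookup cst e i = lookup cst e j).
Proof.
exists 2, (FEq (Var L ord0) (Var L ord_max)), (pair2 i j) => e.
by [].
Qed.

Lemma defin_not I (P : (I -> U) -> Prop) : def P -> def (fun e => ~ P e).
Proof. by move=> dP; apply: defin_imp => //; apply: defin_bot. Qed.

Lemma defin_and I (P Q : (I -> U) -> Prop) :
  def P -> def Q -> def (fun e => P e /\ Q e).
Proof.
move=> dP dQ; apply: (@defin_ext _ (fun e => ~ (P e -> ~ Q e))).
  by move=> e; tauto.
by apply/defin_not/defin_imp => //; apply: defin_not.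
Qed.

Lemma defin_ex I (P : U -> (I -> U) -> Prop) :
  def (fun e : option I -> U => P (e None) (fun i => e (Some i))) ->
  def (fun e => exists u, P u e).
Proof.
move=> dP; apply: (@defin_ext _ (fun e => ~ (forall u, ~ P u e))).
  move=> e; split=> [/not_all_ex_not [u /NNPP]|[u p] /(_ u)] //.
  by exists u.
by apply/defin_not/(@defin_all _ (fun u e => ~ P u e))/defin_not.
Qed.

Lemma defin_iff I (P Q : (I -> U) -> Prop) :
  def P -> def Q -> def (fun e => P e <-> Q e).
Proof. by move=> dP dQ; apply: defin_and; apply: defin_imp. Qed.

Lemma defin_forall_ord I n (P : 'I_n -> (I -> U) -> Prop) :
  (forall j, def (P j)) -> def (fun e => forall j, P j e).
Proof.
elim: n P => [|n IH] P dP.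
  apply: (@defin_ext _ (fun e => False -> False)); last first.
    by apply: defin_imp; apply: defin_bot.
  by move=> e; split=> // _ [].
apply: (@defin_ext _ (fun e => P ord0 e /\ forall j, P (lift ord0 j) e)).
  move=> e; split=> [[p0 pS] j|p]; last by split.
  by case: (unliftP ord0 j) => [i ->|->].
by apply: defin_and => //; apply: IH.
Qed.

(** Boxes range over tuples whose length is not known in advance, so their
quantifiers are iterated single quantifiers. *)
Lemma defin_all_tuple I n (P : ('I_n -> U) -> (I -> U) -> Prop) :
  def (fun e : ('I_n + I)%type -> U =>
         P (fun j => e (inl j)) (fun i => e (inr i))) ->
  def (fun e => forall z, P z e).
Proof.
elim: n I P => [|n IH] I P dP.
  pose g (a : 'I_0 + I) : I + K :=
    match a with inl j => inr k0 | inr i => inl i end.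
  apply: defin_ext (defin_subst g dP) => e /=; split=> [p z|]; last exact.
  suff -> : z = (fun _ => cst k0) by [].
  by apply: functional_extensionality; case.
pose Q u (e : I -> U) := forall z : 'I_n -> U, P (fcons u z) e.
apply: (@defin_ext _ (fun e => forall u, Q u e)).
  by move=> e; split=> [p z|p u z]; [rewrite -[z]fcons_eta; apply: p|apply: p].
apply: (@defin_all _ Q); rewrite /Q.
apply: (IH _ (fun z e => P (fcons (e None) z) (fun i => e (Some i)))).
pose g (a : 'I_n.+1 + I) : ('I_n + option I) + K :=
  match a with
  | inl j => fcons (inl (inr None)) (fun j => inl (inl j)) j
  | inr i => inl (inr (Some i)) end.
apply: defin_ext (defin_subst g dP) => e /=.
suff -> : (fun j => lookup cst e (fcons (inl (inr None)) (fun j => inl (inl j)) j))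
  = fcons (e (inr None)) (fun j => e (inl j)) by [].
by apply: functional_extensionality => j; rewrite -(fcons_map (lookup cst e)).
Qed.

Lemma defin_ex_tuple I n (P : ('I_n -> U) -> (I -> U) -> Prop) :
  def (fun e : ('I_n + I)%type -> U =>
         P (fun j => e (inl j)) (fun i => e (inr i))) ->
  def (fun e => exists z, P z e).
Proof.
move=> dP; apply: (@defin_ext _ (fun e => ~ (forall z, ~ P z e))).
  move=> e; split=> [/not_all_ex_not [u /NNPP]|[u p] /(_ u)] //.
  by exists u.
by apply/defin_not/(@defin_all_tuple _ _ (fun u e => ~ P u e))/defin_not.
Qed.

End Rules.

Lemma defin_cst K (cst : K -> U) I (P : (I -> U) -> Prop) :
  defin cst P -> defin (fun u : U => u) P.
Proof.
move=> [n [phi [s H]]].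
exists n, phi, (fun i => match s i with inl i => inl i | inr k => inr (cst k) end).
move=> e; rewrite H; set a := (fun i => _); set b := (fun i => _).
suff -> : a = b by [].
by apply: functional_extensionality => i; rewrite /a /b; case: (s i).
Qed.

(** The parameters of a definition can be turned into variables: [D] uses no
constants, whatever the type [K] of constants. *)
Lemma defin_parameters K (cst : K -> U) (u0 : U) I (P : (I -> U) -> Prop) :
  defin (fun u : U => u) P ->
  exists k (c : 'I_k -> U) (D : (I -> U) -> ('I_k -> U) -> Prop),
    defin2 cst D /\
    forall e, P e <-> D e c.
Proof.
move=> [n [phi [s H]]].
pose c i := if s i is inr u then u else u0.
exists n, c, (fun e z => sat N phi (fun i => if s i is inl j then e j else z i)).
split.
  exists n, phi, (fun i => if s i is inl j then inl (inl j) else inl (inr i)) => e.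
  set a := (fun i => _); set b := (fun i => _).
  suff -> : a = b by [].
  by apply: functional_extensionality => i; rewrite /a /b; case: (s i).
move=> e; rewrite H /c; set a := (fun i => _); set b := (fun i => _).
suff -> : a = b by [].
by apply: functional_extensionality => i; rewrite /a /b; case: (s i).
Qed.

End Definability.

(** * Orders all of whose definable sets are finite unions of intervals *)

Section OMinimality.
Set Implicit Arguments.
Unset Strict Implicit.
Variables (L : language) (U : Type) (N : structure L U).

(** The consequences of o-minimality that matter below.  Unlike o-minimality
itself they are stable under reversal of the order, since [lt] need only be
definable and not be the interpretation of the order symbol. *)
Record omin_order (lt : U -> U -> Prop) : Prop := OminOrder {
  omin_dlo : dense_linear_order lt;
  omin_below : forall x, exists y, lt y x;
  omin_above : forall x, exists y, lt x y;
  omin_lt : exists phi : formula L 2,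
    forall x y, lt x y <-> sat N phi (pair2 x y);
  omin_sets : forall X : U -> Prop,
    defin N id (fun e : unit -> U => X (e tt)) ->
    exists m (A : 'I_m -> U -> Prop),
      (forall i, point_or_interval lt (A i)) /\
      (forall x, X x <-> exists i, A i x) }.

Definition flip (A : Type) (lt : A -> A -> Prop) x y := lt y x.

Definition eflip (A : Type) (a : ext A) : ext A :=
  match a with NInf => PInf | Fin x => Fin x | PInf => NInf end.

Lemma ext_lt_flip A (lt : A -> A -> Prop) a b :
  ext_lt (flip lt) (eflip a) (eflip b) <-> ext_lt lt b a.
Proof. by case: a b => [|a|] [|b|]. Qed.

Lemma eflipK A : involutive (@eflip A).
Proof. by case. Qed.

Lemma itv_flip A (lt : A -> A -> Prop) a b x :
  itv (flip lt) (eflip a) (eflip b) x <-> itv lt b a x.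
Proof. by case: a b => [|a|] [|b|]; rewrite /itv /flip /=; tauto. Qed.

Lemma omin_order_flip lt : omin_order lt -> omin_order (flip lt).
Proof.
case=> -[irr tr tot dns] bel abv [phi Hphi] sets; split=> //.
- split=> //; rewrite /flip.
  + by move=> x y z xy yz; apply: tr yz xy.
  + by move=> x y; case: (tot x y) => H; [apply: Or33|apply: Or32|apply: Or31].
  + by move=> x y /dns [z [? ?]]; exists z.
- exists (rename phi (pair2 ord_max ord0)) => x y; rewrite sat_rename /flip Hphi.
  set a := (fun i => _); suff -> : a = pair2 y x by [].
  by apply: functional_extensionality => i; rewrite /a /pair2; case: (i == ord0).
- move=> X /sets [m [A [HA HX]]]; exists m, A; split=> // i.
  case: (HA i) => [|[a [b Hab]]]; [by left|right].
  by exists (eflip b), (eflip a) => x; rewrite itv_flip.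
Qed.

Variable lt : U -> U -> Prop.
Hypothesis Hlt : omin_order lt.

Lemma lt_irr x : ~ lt x x. Proof. by case: Hlt => -[]. Qed.
Lemma lt_trans x y z : lt x y -> lt y z -> lt x z.
Proof. by case: Hlt => -[_ + _ _ _ _ _ _]; apply. Qed.
Lemma lt_total x y : [\/ lt x y, x = y | lt y x].
Proof. by case: Hlt => -[]. Qed.
Lemma lt_dense x y : lt x y -> exists z, lt x z /\ lt z y.
Proof. by case: Hlt => -[_ _ _ + _ _ _ _]; apply. Qed.

Lemma ext_lt_total a b : [\/ ext_lt lt a b, a = b | ext_lt lt b a].
Proof.
case: a b => [|a|] [|b|] /=; try by [apply: Or31|apply: Or32|apply: Or33].
by case: (lt_total a b) => [H|->|H]; [apply: Or31|apply: Or32|apply: Or33].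
Qed.

Lemma ext_lt_trans a b c : ext_lt lt a b -> ext_lt lt b c -> ext_lt lt a c.
Proof. by case: a b c => [|a|] [|b|] [|c|] //=; apply: lt_trans. Qed.

Lemma ext_lt_irr a : ~ ext_lt lt a a.
Proof. by case: a => //= x; apply: lt_irr. Qed.

Lemma not_ext_lt_trans a b c :
  ~ ext_lt lt b a -> ext_lt lt b c -> ext_lt lt a c.
Proof. by case: (ext_lt_total a b) => [ab _|->|] //; apply: ext_lt_trans. Qed.

Lemma ext_lt_not_trans a b c :
  ext_lt lt a b -> ~ ext_lt lt c b -> ext_lt lt a c.
Proof. by case: (ext_lt_total b c) => [bc ab _|->|] //; apply: ext_lt_trans bc. Qed.

Lemma ext_lt_min a r s : ext_lt lt a (Fin r) -> ext_lt lt a (Fin s) ->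
  exists t, [/\ ext_lt lt a (Fin t),
    forall x, lt x t -> lt x r & forall x, lt x t -> lt x s].
Proof.
case: (lt_total r s) => [rs ar _|->|sr _ as_].
- by exists r; split=> // x xr; apply: lt_trans rs.
- by exists s; split.
- by exists s; split=> // x xs; apply: lt_trans sr.
Qed.

Lemma defin_lt K (cst : K -> U) I (i j : I + K) :
  defin N cst (fun e : I -> U => lt (lookup cst e i) (lookup cst e j)).
Proof.
have [phi Hphi] := omin_lt Hlt; exists 2, phi, (pair2 i j) => e; rewrite Hphi.
set b := (fun k => _); suff <- : pair2 (lookup cst e i) (lookup cst e j) = b by [].
by apply: functional_extensionality => k; rewrite /b /pair2; case: (k == ord0).
Qed.

(** Finite unions of points and intervals are obtained from these by binary
unions. *)
Lemma defin_set_ind (Phi : (U -> Prop) -> Prop) :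
  (forall A B, (forall x, A x <-> B x) -> Phi A -> Phi B) ->
  Phi (fun=> False) ->
  (forall A B, Phi A -> Phi B -> Phi (fun x => A x \/ B x)) ->
  (forall A, point_or_interval lt A -> Phi A) ->
  forall X, defin N id (fun e : unit -> U => X (e tt)) -> Phi X.
Proof.
move=> Pext P0 PU PA X /(omin_sets Hlt) [m [A [HA HX]]].
apply: (Pext (fun x => exists i, A i x)) => [x|]; first by rewrite HX.
elim: m A HA {X HX} => [|m IH] A HA.
  by apply: Pext P0 => x; split=> // -[[]].
apply: (Pext (fun x => A ord0 x \/ exists i, A (lift ord0 i) x)).
  move=> x; split=> [[|[i]]|[i]]; [by exists ord0|by exists (lift ord0 i)|].
  by case: (unliftP ord0 i) => [j ->|->]; [right; exists j|left].
by apply: PU; [apply: PA|apply: IH].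
Qed.

(** For [a = NInf] this means eventually towards the left end of the order. *)
Definition near_right (a : ext U) (P : U -> Prop) :=
  exists r, ext_lt lt a (Fin r) /\ forall x, itv lt a (Fin r) x -> P x.

Lemma near_right_and a P Q : near_right a P -> near_right a Q ->
  near_right a (fun x => P x /\ Q x).
Proof.
move=> [r [ar HP]] [s [as_ HQ]]; have [t [at_ tr ts]] := ext_lt_min ar as_.
by exists t; split=> // x [ax xt]; split; [apply: HP|apply: HQ]; split=> //=; auto.
Qed.

Lemma near_right_imp a (P Q : U -> Prop) :
  (forall x, ext_lt lt a (Fin x) -> P x -> Q x) ->
  near_right a P -> near_right a Q.
Proof. by move=> PQ [r [ar HP]]; exists r; split=> // x [ax xr]; apply/PQ/HP. Qed.

Lemma near_right_self (u0 : U) a : ext_lt lt a (@PInf U) ->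
  exists r, ext_lt lt a (Fin r).
Proof.
case: a => [|a|] //= _; exact: omin_above Hlt a.
Qed.

(** The property passes to unions, and a point or an interval either contains an
interval with left end [a] or misses one. *)
Lemma near_right_dichotomy (u0 : U) a X : ext_lt lt a (@PInf U) ->
  defin N id (fun e : unit -> U => X (e tt)) ->
  near_right a X \/ near_right a (fun x => ~ X x).
Proof.
move=> aoo; have [r0 ar0] := near_right_self u0 aoo.
move: X; apply: defin_set_ind.
- move=> A B AB [H|H]; [left|right]; apply: near_right_imp H => x _; rewrite AB //.
- by right; exists r0; split=> // x _ [].
- move=> A B [HA|HA]; first by left; apply: near_right_imp HA => x _; left.
  case=> HB; first by left; apply: near_right_imp HB => x _; right.
  by right; apply: near_right_imp (near_right_and HA HB) => x _ []; tauto.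
- move=> A [[p Hp]|[b [c Hbc]]].
    right; case: (classic (ext_lt lt a (Fin p))) => ap.
      by exists p; split=> // x [_ /= xp] /Hp xE; move: xp; rewrite xE; apply: lt_irr.
    by exists r0; split=> // x [ax _] /Hp xE; apply: ap; rewrite -xE.
  case: (classic (ext_lt lt a b)) => ab.
    right; case: b ab Hbc => [|b|] ab Hbc; first by case: a ab {aoo ar0}.
      by exists b; split=> // x [_ xb] /Hbc [bx _]; apply: (lt_irr (lt_trans xb bx)).
    by exists r0; split=> // x _ /Hbc [].
  case: (classic (ext_lt lt a c)) => ac; last first.
    right; exists r0; split=> // x [ax _] /Hbc [_ xc].
    by apply: ac; apply: ext_lt_trans xc.
  left; case: c ac Hbc => [|c|] ac Hbc; first by case: a ac {aoo ar0 ab}.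
    exists c; split=> // x [ax xc]; apply/Hbc; split=> //.
    exact: not_ext_lt_trans ax.
  exists r0; split=> // x [ax xc]; apply/Hbc; split=> //.
  exact: not_ext_lt_trans ax.
Qed.

(** The second clause is stated with [~ lt x v] so that a largest element of [X]
is allowed; the supremum of the empty set is [NInf]. *)
Lemma defin_sup X : defin N id (fun e : unit -> U => X (e tt)) ->
  exists l : ext U, (forall x, X x -> ~ ext_lt lt l (Fin x)) /\
    (forall v, ext_lt lt (Fin v) l -> exists x, X x /\ ~ lt x v).
Proof.
move: X; apply: defin_set_ind.
- move=> A B AB [l [l1 l2]]; exists l; split=> [x /AB|v /l2 [x [/AB]]]; first exact: l1.
  by exists x.
- by exists (@NInf U).
- move=> A B [l [l1 l2]] [m [m1 m2]].
  wlog lm : A B l m l1 l2 m1 m2 / ~ ext_lt lt m l.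
    move=> H; case: (ext_lt_total m l) => ml.
    - have [] // := H B A m l m1 m2 l1 l2.
        by move=> lm; apply: (ext_lt_irr (ext_lt_trans lm ml)).
      move=> o [o1 o2]; exists o; split=> [x ?|v /o2 [x [? ?]]].
        by apply: o1; tauto.
      by exists x; split=> //; tauto.
    - by apply: (H A B l m) => //; rewrite ml; apply: ext_lt_irr.
    - by apply: (H A B l m) => // lm; apply: (ext_lt_irr (ext_lt_trans lm ml)).
  exists m; split=> [x [/l1 lx|/m1 //]|v /m2 [x [? ?]]].
    by move=> mx; apply: lx; apply: not_ext_lt_trans mx.
  by exists x; split=> //; right.
- move=> A [[p Hp]|[b [c Hbc]]].
    exists (Fin p); split=> [x /Hp ->|v /= vp]; first exact: ext_lt_irr.
    exists p; split; first exact/Hp.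
    by move=> pv; apply: (lt_irr (lt_trans pv vp)).
  case: (classic (exists x, A x)) => [[x0 Ax0]|no]; last first.
    by exists (@NInf U); split=> // x Ax; case: no; exists x.
  exists c; split=> [x /Hbc [_ xc] cx|v vc].
    exact: (ext_lt_irr (ext_lt_trans cx xc)).
  case: (classic (ext_lt lt b (Fin v))) => bv.
    by exists v; split; [exact/Hbc|apply: lt_irr].
  exists x0; split=> // x0v; apply: bv.
  by move/Hbc: Ax0 => [bx0 _]; apply: ext_lt_trans bx0 _.
Qed.

(** O-minimal intervals are definably connected: were [X] to hold at [x] and fail
at [y > x], the supremum of the points up to which [X] holds from [x] on would
have no neighbourhood on which [X] is constant. *)
Lemma connected_interval (p q : U) (X : U -> Prop) :
  defin N id (fun e : unit -> U => X (e tt)) ->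
  (forall x, lt p x -> lt x q -> exists p' q', [/\ lt p' x, lt x q' &
     forall y, lt p y -> lt y q -> lt p' y -> lt y q' -> (X y <-> X x)]) ->
  forall x y, lt p x -> lt x q -> lt p y -> lt y q -> X x -> X y.
Proof.
move=> dX loc x y px xq py yq.
suff step : forall Y x y, defin N id (fun e : unit -> U => Y (e tt)) ->
    (forall x, lt p x -> lt x q -> exists p' q', [/\ lt p' x, lt x q' &
     forall y, lt p y -> lt y q -> lt p' y -> lt y q' -> (Y y <-> Y x)]) ->
    lt p x -> lt y q -> lt x y -> Y x -> Y y.
  case: (lt_total x y) => [xy|->|yx] //; first exact: (step X x y).
  move=> Xx; apply: NNPP => nXy.
  apply: (step (fun z => ~ X z) y x) => //; first exact: defin_not.
  move=> z pz zq; have [p' [q' [p'z zq' H]]] := loc z pz zq.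
  by exists p', q'; split=> // w pw wq p'w wq'; rewrite H.
move=> {dX loc px xq py yq x y} {}X x y dX loc px yq xy Xx.
pose S w := forall v, lt x v -> ~ lt w v -> X v.
have dS : defin N id (fun e : unit -> U => S (e tt)).
  apply: (defin_all y (P := fun v e => lt x v -> ~ lt (e tt) v -> X v)).
  apply: defin_imp; first exact: (defin_lt _ (inr _) (inl _)).
  apply: defin_imp; first by apply: (defin_not y); exact: (defin_lt _ (inl _) (inl _)).
  exact: (defin_subst (fun=> inl _) dX).
have [l [l1 l2]] := defin_sup dS.
apply: NNPP => nXy.
have nS w : S w -> lt w y by move=> Sw; apply: NNPP => wy; apply: nXy; apply: Sw.
have Sx : S x by move=> v xv [].
case: l l1 l2 => [|l|] l1 l2; first by case: (l1 x Sx).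
  have xl : ~ lt l x by apply: l1.
  have ly : ~ lt y l by move=> /l2 [w [/nS]].
  have pl : lt p l by apply: (ext_lt_not_trans (a := Fin p) (b := Fin x) (c := Fin l)) px xl.
  have lq : lt l q by apply: (not_ext_lt_trans (a := Fin l) (b := Fin y) (c := Fin q)) ly yq.
  have [p' [q' [p'l lq' H]]] := loc l pl lq.
  have below v : lt x v -> lt v l -> X v.
    by move=> xv /l2 [w [Sw wv]]; apply: Sw.
  have Xl : X l.
    case: (lt_total x l) => [xl'|<- //|//].
    have [t [/= tl ht1 ht2]] : exists t, [/\ lt t l, lt x t \/ x = t & lt p' t \/ p' = t].
      case: (lt_total x p') => [xp'|->|p'x].
      - by exists p'; split=> //; [left|right].
      - by exists p'; split=> //; right.
      - by exists x; split=> //; [right|left].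
    have [v [tv vl]] := lt_dense tl.
    have xv : lt x v by case: ht1 => [/lt_trans|->]; [apply|].
    have p'v : lt p' v by case: ht2 => [/lt_trans|->]; [apply|].
    apply/(H v) => //; [exact: lt_trans xv|exact: lt_trans lq|exact: lt_trans lq'|].
    exact: below.
  have [t [/= lt_ tq' tq]] := ext_lt_min (a := Fin l) (r := q') (s := q) lq' lq.
  have [v [lv vt]] := lt_dense lt_.
  apply: (l1 v) => // u xu vu; case: (lt_total u l) => [|->|lu] //; first exact: below.
  have ut : lt u t by apply: (not_ext_lt_trans (a := Fin u) (b := Fin v) (c := Fin t)).
  by apply/(H u) => //; [apply: lt_trans lu|apply: tq|apply: lt_trans lu|apply: tq'].
by have [w [/nS]] := l2 y I.
Qed.

Definition box k (p q z : 'I_k -> U) := forall j, lt (p j) (z j) /\ lt (z j) (q j).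

(** Two points of a box are joined by changing one coordinate at a time, along
which [connected_interval] applies. *)
Lemma connected_box k (p q : 'I_k -> U) (X : ('I_k -> U) -> Prop) :
  defin N id X ->
  (forall z, box p q z -> exists p' q', box p' q' z /\
     forall y, box p q y -> box p' q' y -> (X y <-> X z)) ->
  forall z y, box p q z -> box p q y -> X z -> X y.
Proof.
move=> dX loc z y bz by_.
suff agree n : forall z, box p q z -> (forall j : 'I_k, n <= j -> z j = y j) ->
    X z -> X y.
  by apply: (agree k z) => // j; rewrite leqNgt ltn_ord.
elim: n => [|n IH] {}z {}bz zy Xz.
  suff <- : z = y by [].
  by apply: functional_extensionality => j; apply: zy.
case: (ltnP n k) => [nk|kn]; last first.
  apply: (IH z) => // j nj.
  by have := leq_trans (ltn_ord j) (leq_trans kn nj); rewrite ltnn.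
pose o := Ordinal nk; pose zv v j := if j == o then v else z j.
have bzv v : lt (p o) v -> lt v (q o) -> box p q (zv v).
  by move=> pv vq j; rewrite /zv; case: eqP => [->|].
apply: (IH (zv (y o))); first by case: (by_ o); apply: bzv.
  move=> j nj; rewrite /zv; case: eqP => [->|jo] //; apply: zy.
  by rewrite ltn_neqAle nj andbT; apply/eqP => nj'; apply: jo; apply: val_inj.
have zE : z = zv (z o).
  by apply: functional_extensionality => j; rewrite /zv; case: eqP => [->|].
have [pz zq] := bz o; have [py yq] := by_ o.
move: Xz; rewrite {1}zE.
apply: (connected_interval (p := p o) (q := q o) (X := fun v => X (zv v))) => //.
  pose g j : unit + U := if j == o then inl tt else inr (z j).
  apply: defin_ext (defin_subst g dX) => e; rewrite /zv /g.
  set a := (fun j => _); set b := (fun j => _); suff -> : a = b by [].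
  by apply: functional_extensionality => j; rewrite /a /b; case: eqP.
move=> v pv vq; have [p' [q' [b H]]] := loc _ (bzv v pv vq).
exists (p' o), (q' o); have := b o; rewrite {1 2}/zv eqxx => -[p'v vq'].
split=> // w pw wq p'w wq'; apply: H; first exact: bzv.
by move=> j; have := b j; rewrite /zv; case: eqP => [->|].
Qed.


End OMinimality.

(** * Generic parameters over a dense elementary substructure *)

Section Generic.
Set Implicit Arguments.
Unset Strict Implicit.
Variables (L : language) (U T : Type) (N : structure L U) (iota : T -> U).
Variable (lt : U -> U -> Prop).

(** All that is used of elementarity once formulas are left behind. *)
Definition tarski_vaught := forall Q : U -> Prop,
  defin N iota (fun e : unit -> U => Q (e tt)) ->
  (exists u, Q u) -> exists t, Q (iota t).

Definition dense_image := forall u v, lt u v ->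
  exists x, lt u (iota x) /\ lt (iota x) v.

Hypothesis Hlt : omin_order N lt.
Hypothesis TV : tarski_vaught.
Hypothesis dense : dense_image.
Variable t0 : T.

Local Notation Mdef := (defin N iota).
Local Notation Ndef := (defin N (@id U)).

Definition near k (z : 'I_k -> U) (A : ('I_k -> U) -> Prop) :=
  exists p q, box lt p q z /\ forall w, box lt p q w -> A w.

Definition generic k (c : 'I_k -> U) :=
  forall P : ('I_k -> U) -> Prop, Mdef P -> P c ->
  exists p q : 'I_k -> T, box lt (iota \o p) (iota \o q) c /\
    forall w, box lt (iota \o p) (iota \o q) w -> P w.

Lemma defin_box I k (p q z : 'I_k -> I + T) :
  Mdef (fun e : I -> U => box lt (fun j => lookup iota e (p j))
    (fun j => lookup iota e (q j)) (fun j => lookup iota e (z j))).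
Proof.
apply: (defin_forall_ord t0) => j.
by apply: (defin_and t0); apply: defin_lt.
Qed.

Lemma defin_near I k (D : (I -> U) -> ('I_k -> U) -> Prop) :
  defin2 N iota D -> defin2 N iota (fun e z => near z (D e)).
Proof.
move=> dD; rewrite /defin2 /near.
apply: (defin_ex_tuple t0 (P := fun p e => exists q,
  box lt p q (fun j => e (inr j)) /\
  forall w, box lt p q w -> D (fun i => e (inl i)) w)).
apply: (defin_ex_tuple t0 (P := fun q e =>
  box lt (fun j => e (inl j)) q (fun j => e (inr (inr j))) /\
  forall w, box lt (fun j => e (inl j)) q w -> D (fun i => e (inr (inl i))) w)).
apply: (defin_and t0).
  exact: (defin_box (fun j => inl (inr (inl j))) (fun j => inl (inl j))
    (fun j => inl (inr (inr (inr j))))).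
apply: (defin_all_tuple t0 (P := fun w e =>
  box lt (fun j => e (inr (inl j))) (fun j => e (inl j)) w ->
  D (fun i => e (inr (inr (inl i)))) w)).
apply: (defin_imp).
  exact: (defin_box (fun j => inl (inr (inr (inl j)))) (fun j => inl (inr (inl j)))
    (fun j => inl (inl j))).
exact: (defin2_app (g := fun i => inl (inr (inr (inr (inl i)))))
  (h := fun j => inl (inl j)) dD).
Qed.

(** By density the endpoints of the box can be moved into T. *)
Lemma near_box k (c : 'I_k -> U) A : near c A ->
  exists p q : 'I_k -> T, box lt (iota \o p) (iota \o q) c /\
    forall w, box lt (iota \o p) (iota \o q) w -> A w.
Proof.
move=> [p [q [bc HA]]].
have [p' Hp] : exists p' : 'I_k -> T, forall j,
    lt (p j) (iota (p' j)) /\ lt (iota (p' j)) (c j).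
  apply: (fin_all_exists (P := fun j t => lt (p j) (iota t) /\ lt (iota t) (c j))).
  by move=> j; case: (bc j) => pc _; apply: dense.
have [q' Hq] : exists q' : 'I_k -> T, forall j,
    lt (c j) (iota (q' j)) /\ lt (iota (q' j)) (q j).
  apply: (fin_all_exists (P := fun j t => lt (c j) (iota t) /\ lt (iota t) (q j))).
  by move=> j; case: (bc j) => _ cq; apply: dense.
exists p', q'; split=> [j|w bw]; first by case: (Hp j) (Hq j) => _ + [].
apply: HA => j; case: (Hp j) (Hq j) (bw j) => /= pp _ [_ qq] [pw wq].
by split; [exact: (lt_trans Hlt pp pw)|exact: (lt_trans Hlt wq qq)].
Qed.

(** Being true on a box is a statement that can be quantified over T, which is
why genericity is useful. *)
Lemma generic_near k (c : 'I_k -> U) P : generic c -> Mdef P ->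
  (P c <-> near c P).
Proof.
move=> gc dP; split=> [/(gc P dP) [p [q H]]|[p [q [bc]]]]; last exact.
by exists (iota \o p), (iota \o q).
Qed.

(** The box around [c] may be taken with endpoints in T.  The condition on [v]
that [D v] holds on that box no longer mentions [c], so it has a solution in T. *)
Lemma near_tarski_vaught k (c : 'I_k -> U) (D : U -> ('I_k -> U) -> Prop) :
  Mdef (fun e : option 'I_k -> U => D (e None) (fun j => e (Some j))) ->
  (exists v, near c (D v)) -> exists t, D (iota t) c.
Proof.
move=> dD [v /near_box [p [q [bc HD]]]].
have [||t Ht] := TV (Q := fun v => forall w, box lt (iota \o p) (iota \o q) w -> D v w).
- apply: (defin_all_tuple t0 (P := fun w e =>
    box lt (iota \o p) (iota \o q) w -> D (e tt) w)).
  apply: defin_imp.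
    exact: (defin_box (fun j => inr (p j)) (fun j => inr (q j)) (fun j => inl (inl j))).
  pose g i : ('I_k + unit) + T := if i is Some j then inl (inl j) else inl (inr tt).
  exact: (defin_subst g dD).
- by exists v.
- by exists t; apply: Ht.
Qed.

Lemma defin_fcons K (cst : K -> U) k (P : ('I_k.+1 -> U) -> Prop) : defin N cst P ->
  defin N cst (fun e : option 'I_k -> U => P (fcons (e None) (fun j => e (Some j)))).
Proof.
move=> dP; pose g := fcons (inl None) (fun j => inl (Some j)) : 'I_k.+1 -> option 'I_k + K.
by apply: (defin_app (g := g) dP) => e i; rewrite -(fcons_map (lookup cst e)).
Qed.

(** Let [X] be the fibre over [c] of a T-definable set containing [(c, d)].  On
each side of [d] it contains or misses a whole interval, ending at a point of T
by density.  If it contains both, then the union is a condition on [c] alone and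
genericity of [c] applies.  If it misses one, then [d] is the only point
between these two elements of T that lies in [X] but not in its interior, and so
[d] is definable over [c]. *)
Lemma generic_cons k (c : 'I_k -> U) d : generic c ->
  (forall R : U -> ('I_k -> U) -> Prop,
    Mdef (fun e : option 'I_k -> U => R (e None) (fun j => e (Some j))) ->
    ~ (forall v, R v c <-> v = d)) ->
  generic (fcons d c).
Proof.
move=> gc notdcl P dP Pd.
have dX : Ndef (fun e : unit -> U => P (fcons (e tt) c)).
  pose g : 'I_k.+1 -> unit + U := fcons (inl tt) (fun j => inr (c j)).
  by apply: (defin_app (g := g) (defin_cst dP)) => e i; rewrite -(fcons_map (lookup id e)).
have [q0 [dq0 Hq]] : exists q0, lt d q0 /\
    ((forall x, lt d x -> lt x q0 -> P (fcons x c)) \/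
     (forall x, lt d x -> lt x q0 -> ~ P (fcons x c))).
  have [] := near_right_dichotomy Hlt d (a := Fin d) (X := fun v => P (fcons v c)) I dX;
    move=> [q0 [dq0 H]]; exists q0; split=> //.
    by left=> x ? ?; apply: H.
  by right=> x ? ?; apply: H.
have [p0 [pd0 Hp]] : exists p0, lt p0 d /\
    ((forall x, lt p0 x -> lt x d -> P (fcons x c)) \/
     (forall x, lt p0 x -> lt x d -> ~ P (fcons x c))).
  have [] := near_right_dichotomy (omin_order_flip Hlt) d (a := Fin d) (X := fun v => P (fcons v c)) I dX;
    move=> [p0 [dp0 H]]; exists p0; split=> //.
    by left=> x ? ?; apply: H.
  by right=> x ? ?; apply: H.
have [p [p0p pd]] := dense pd0; have [q [dq qq0]] := dense dq0.
have Hp' x : lt (iota p) x -> lt p0 x by apply: (lt_trans Hlt p0p).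
have Hq' x : lt x (iota q) -> lt x q0 by move=> xq; apply: (lt_trans Hlt xq qq0).
(* [R v z]: [v] lies in the part between [p] and [q] of the fibre over [z],
   but not in the interior of the fibre *)
pose inside v z := exists p' q', [/\ lt p' v, lt v q' &
  forall w, lt p' w -> lt w q' -> P (fcons w z)].
pose R v z := [/\ lt (iota p) v, lt v (iota q), P (fcons v z) & ~ inside v z].
have dR : Mdef (fun e : option 'I_k -> U => R (e None) (fun j => e (Some j))).
  apply: (defin_ext (P := fun e : option 'I_k -> U => lt (iota p) (e None) /\
    (lt (e None) (iota q) /\ (P (fcons (e None) (fun j => e (Some j))) /\
     ~ (exists p' q', lt p' (e None) /\ (lt (e None) q' /\
       forall w, lt p' w -> lt w q' -> P (fcons w (fun j => e (Some j))))))))).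
    move=> e; split=> [[? [? [? ni]]]|[? ? ? ni]]; repeat split=> //.
      by move=> [p' [q' [? ? ?]]]; apply: ni; exists p', q'.
    by move=> [p' [q' [? [? ?]]]]; apply: ni; exists p', q'.
  apply: (defin_and t0); first exact: (defin_lt Hlt iota (inr _) (inl _)).
  apply: (defin_and t0); first exact: (defin_lt Hlt iota (inl _) (inr _)).
  apply: (defin_and t0); first exact: defin_fcons.
  apply: (defin_not t0).
  apply: (defin_ex t0 (P := fun p' e => exists q', lt p' (e None) /\
    (lt (e None) q' /\ forall w, lt p' w -> lt w q' ->
      P (fcons w (fun j => e (Some j)))))).
  apply: (defin_ex t0 (P := fun q' e => lt (e None) (e (Some None)) /\
    (lt (e (Some None)) q' /\ forall w, lt (e None) w -> lt w q' ->
      P (fcons w (fun j => e (Some (Some j))))))).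
  apply: (defin_and t0); first exact: (defin_lt Hlt iota (inl _) (inl _)).
  apply: (defin_and t0); first exact: (defin_lt Hlt iota (inl _) (inl _)).
  apply: (defin_all t0 (P := fun w e => lt (e (Some None)) w -> lt w (e None) ->
      P (fcons w (fun j => e (Some (Some (Some j))))))).
  apply: defin_imp; first exact: (defin_lt Hlt iota (inl _) (inl _)).
  apply: defin_imp; first exact: (defin_lt Hlt iota (inl _) (inl _)).
  pose g (i : option 'I_k) : option (option (option (option 'I_k))) + T :=
    inl (if i is Some j then Some (Some (Some (Some j))) else None).
  exact: (defin_subst g (defin_fcons dP)).
case: (classic ((forall x, lt p0 x -> lt x d -> P (fcons x c)) /\
  (forall x, lt d x -> lt x q0 -> P (fcons x c)))) => [[inl_ inr_]|notin].
  pose P' z := forall v, lt (iota p) v -> lt v (iota q) -> P (fcons v z).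
  have dP' : Mdef P'.
    apply: (defin_all t0 (P := fun v e =>
      lt (iota p) v -> lt v (iota q) -> P (fcons v e))).
    apply: defin_imp; first exact: (defin_lt Hlt iota (inr _) (inl _)).
    apply: defin_imp; first exact: (defin_lt Hlt iota (inl _) (inr _)).
    exact: defin_fcons.
  have [|p' [q' [b HP']]] := gc P' dP'.
    move=> v /Hp' pv /Hq' vq.
    by case: (lt_total Hlt v d) => [vd|->|dv] //; [apply: inl_|apply: inr_].
  exists (fcons p p'), (fcons q q'); split=> [j|w bw].
    case: (unliftP ord0 j) => [i ->|->]; rewrite /= ?fcons_lift ?fcons0 //.
    exact: b.
  rewrite -[w]fcons_eta; have := bw ord0; rewrite /= !fcons0 => -[pw wq].
  apply: HP' => // j; have := bw (lift ord0 j); by rewrite /= !fcons_lift.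
case: (notdcl R dR) => v; split=> [[pv vq Pv ni]|->].
  case: (lt_total Hlt v d) => [vd|//|dv]; exfalso.
  - case: Hp => [Hp|/(_ v (Hp' _ pv) vd) //].
    apply: ni; exists (iota p), d; split=> // w pw wd.
    by apply: Hp => //; apply: Hp'.
  - case: Hq => [Hq|/(_ v dv (Hq' _ vq)) //].
    apply: ni; exists d, (iota q); split=> // w dw wq.
    by apply: Hq => //; apply: Hq'.
split=> // -[p' [q' [p'd dq' H]]]; apply: notin; split.
  case: Hp => // Hp.
  have [t [/= dt tp' tp0]] := ext_lt_min (omin_order_flip Hlt) (a := Fin d) p'd pd0.
  have [w [tw wd]] := lt_dense Hlt dt.
  case: (Hp w (tp0 w tw) wd); apply: H; first exact: tp'.
  exact: (lt_trans Hlt wd dq').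
case: Hq => // Hq.
have [t [/= dt tq' tq0]] := ext_lt_min Hlt (a := Fin d) dq' dq0.
have [w [dw wt]] := lt_dense Hlt dt.
case: (Hq w dw (tq0 w wt)); apply: H; last exact: tq'.
exact: (lt_trans Hlt p'd dw).
Qed.

(** The elements of [c] are treated one by one: an element that is definable over
T and the generic tuple found so far is replaced by its definition, and any
other element is added to the tuple by [generic_cons]. *)
Lemma generic_parameters k (c : 'I_k -> U) :
  exists k' (c' : 'I_k' -> U), generic c' /\
    forall I (D : (I -> U) -> ('I_k -> U) -> Prop), defin2 N iota D ->
    exists D', defin2 N iota D' /\ forall e, D e c <-> D' e c'.
Proof.
elim: k c => [|k IH] c.
  exists 0, c; split=> [P _ Pc|I D dD]; last by exists D.
  exists (fun=> t0), (fun=> t0); split=> [[]|w _] //.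
  suff -> : w = c by [].
  by apply: functional_extensionality; case.
have [k' [c' [gc' Hc']]] := IH (fun j => c (lift ord0 j)).
have reduce I (D : (I -> U) -> ('I_k.+1 -> U) -> Prop) : defin2 N iota D ->
    exists D1 : (option I -> U) -> ('I_k' -> U) -> Prop, defin2 N iota D1 /\
    forall e, D e c <-> D1 (ocons (c ord0) e) c'.
  move=> dD; have [|D1 [dD1 HD1]] := Hc' _ (fun e z =>
      D (fun i => e (Some i)) (fcons (e None) z)).
    pose h : 'I_k.+1 -> option I + 'I_k + T :=
      fcons (inl (inl None)) (fun j => inl (inr j)).
    apply: (defin2_app (g := fun i => inl (inl (Some i))) (h := h) dD) => // e j.
    by rewrite -(fcons_map (lookup iota e)).
  by exists D1; split=> // e; rewrite -HD1 /= fcons_eta.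
case: (classic (exists R : U -> ('I_k' -> U) -> Prop,
    Mdef (fun e : option 'I_k' -> U => R (e None) (fun j => e (Some j))) /\
    forall v, R v c' <-> v = c ord0)) => [[R [dR HR]]|notdcl].
  exists k', c'; split=> // I D /reduce [D1 [dD1 HD1]].
  exists (fun e z => exists v, R v z /\ D1 (ocons v e) z); split.
    rewrite /defin2; apply: (defin_ex t0 (P := fun v e =>
      R v (fun j => e (inr j)) /\ D1 (ocons v (fun i => e (inl i))) (fun j => e (inr j)))).
    apply: (defin_and t0).
      pose g (i : option 'I_k') : option (I + 'I_k') + T :=
        inl (if i is Some j then Some (inr j) else None).
      exact: (defin_subst g dR).
    pose g (i : option I) : option (I + 'I_k') + T :=
      inl (if i is Some j then Some (inl j) else None).
    by apply: (defin2_app (g := g) (h := fun j => inl (Some (inr j))) dD1) => // e [].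
  move=> e; rewrite HD1; split=> [D1c|[v [/HR -> //]]].
  by exists (c ord0); split=> //; apply/HR.
exists k'.+1, (fcons (c ord0) c'); split.
  by apply: generic_cons => // R dR HR; apply: notdcl; exists R.
move=> I D /reduce [D1 [dD1 HD1]].
exists (fun e z => D1 (ocons (z ord0) e) (fun j => z (lift ord0 j))); split.
  pose g (i : option I) : I + 'I_k'.+1 + T :=
    inl (if i is Some j then inl j else inr ord0).
  by apply: (defin2_app (g := g) (h := fun j => inl (inr (lift ord0 j))) dD1) => // e [].
move=> e; rewrite HD1 fcons0.
suff -> : (fun j => fcons (c ord0) c' (lift ord0 j)) = c' by [].
by apply: functional_extensionality => j; rewrite fcons_lift.
Qed.

Lemma defin_generic I (P : (I -> U) -> Prop) : Ndef P ->
  exists k (c : 'I_k -> U) (D : (I -> U) -> ('I_k -> U) -> Prop),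
    [/\ generic c, defin2 N iota D & forall e, P e <-> D e c].
Proof.
move=> /(defin_parameters iota (iota t0)) [k [c [D [dD HD]]]].
have [k' [c' [gc' /(_ I D dD) [D' [dD' HD']]]]] := generic_parameters c.
by exists k', c', D'; split=> // e; rewrite HD.
Qed.

Lemma defin2_const I k (D : (I -> U) -> ('I_k -> U) -> Prop) c :
  defin2 N iota D -> Ndef (fun e => D e c).
Proof.
move=> dD; exact: (defin2_app (g := fun i => inl i) (h := fun j => inr (c j))
  (defin_cst dD)).
Qed.

(** For a generic [c], an element of T solves [D(x, -, c)] iff an element of U
solves it robustly, for all parameters near [c]; the latter is definable in N. *)
Lemma trace_projection I (X : (option I -> U) -> Prop) : Ndef X ->
  exists Y : (I -> U) -> Prop, Ndef Y /\
    forall x : I -> T,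
      (exists t, X (ocons (iota t) (iota \o x))) <-> Y (iota \o x).
Proof.
move=> /defin_generic [k [c [D [gc dD HD]]]].
exists (fun e => exists v, near c (D (ocons v e))); split.
  apply: (defin2_const (D := fun e z => exists v, near z (D (ocons v e)))).
  rewrite /defin2; apply: (defin_ex t0 (P := fun v e =>
    near (fun j => e (inr j)) (D (ocons v (fun i => e (inl i)))))).
  pose g (i : option I) : option (I + 'I_k) + T :=
    inl (if i is Some j then Some (inl j) else None).
  by apply: (defin2_app (g := g) (h := fun j => inl (Some (inr j))) (defin_near dD))
    => // e [].
have dDx (x : I -> T) : Mdef (fun e : option 'I_k -> U =>
    D (ocons (e None) (iota \o x)) (fun j => e (Some j))).
  pose g (i : option I) : option 'I_k + T :=
    if i is Some j then inr (x j) else inl None.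
  by apply: (defin2_app (g := g) (h := fun j => inl (Some j)) dD) => // e [].
move=> x; split=> [[t /HD Ht]|/(near_tarski_vaught (dDx x)) [t Ht]]; last first.
  by exists t; apply/HD.
exists (iota t); apply/(generic_near gc) => //.
pose g (i : option 'I_k) : 'I_k + T := if i is Some j then inl j else inr t.
exact: (defin_subst g (dDx x)).
Qed.

(** * Limits of functions with definable trace *)

Definition emap (a : ext T) : ext U :=
  match a with NInf => NInf | Fin x => Fin (iota x) | PInf => PInf end.

Definition pullback_lt (x y : T) : Prop := lt (iota x) (iota y).

Lemma ext_lt_emap a b : ext_lt pullback_lt a b <-> ext_lt lt (emap a) (emap b).
Proof. by case: a b => [|a|] [|b|]. Qed.

Lemma image_dense a b : ext_lt lt a b -> exists t, itv lt a b (iota t).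
Proof.
case: a b => [|a|] [|b|] //= ab.
- have [y /dense [t [_ tb]]] := omin_below Hlt b; by exists t.
- by exists t0.
- by have [t tab] := dense ab; exists t.
- have [y /dense [t [at_ _]]] := omin_above Hlt a; by exists t.
Qed.

Lemma defin_true I : Mdef (fun _ : I -> U => True).
Proof.
apply: (@defin_ext _ _ _ _ _ _ (fun=> False -> False)); first by [].
by apply: defin_imp; apply: (defin_bot _ _ t0).
Qed.

Lemma defin_ext_lt I (a : ext T) (i : I + T) :
  Mdef (fun e : I -> U => ext_lt lt (emap a) (Fin (lookup iota e i))).
Proof.
case: a => [|a|] /=; [exact: defin_true| |exact: (defin_bot _ _ t0)].
exact: (defin_lt Hlt iota (inr a) i).
Qed.

Lemma defin_near_right I a (P : U -> (I -> U) -> Prop) :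
  Mdef (fun e : option I -> U => P (e None) (fun i => e (Some i))) ->
  Mdef (fun e => near_right lt (emap a) (fun x => P x e)).
Proof.
move=> dP; rewrite /near_right.
apply: (defin_ex t0 (P := fun r e => ext_lt lt (emap a) (Fin r) /\
  forall x, itv lt (emap a) (Fin r) x -> P x e)).
apply: (defin_and t0); first exact: (defin_ext_lt a (inl None)).
apply: (defin_all t0 (P := fun x e => itv lt (emap a) (Fin (e None)) x ->
  P x (fun i => e (Some i)))).
apply: defin_imp.
  apply: (defin_and t0); first exact: (defin_ext_lt a (inl None)).
  exact: (defin_lt Hlt iota (inl None) (inl (Some None))).
pose g (i : option I) : option (option I) + T :=
  inl (if i is Some j then Some (Some j) else None).
exact: (defin_subst g dP).
Qed.

(** The limit is the supremum [l] of the [v] that [G u] eventually exceeds.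
By the dichotomy, [G u] is eventually at most [v] for any larger [v].  The
supremum is defined by a formula over T, so it is infinite or in T. *)
Lemma defin_function_limit a s (G : U -> U -> Prop) :
  Mdef (fun e : bool -> U => G (e true) (e false)) ->
  ext_lt lt (emap a) (Fin s) ->
  (forall u, itv lt (emap a) (Fin s) u -> exists v, forall w, G u w <-> w = v) ->
  exists l : ext T, forall c d,
    ext_lt lt c (emap l) \/ c = NInf -> ext_lt lt (emap l) d \/ d = PInf ->
    near_right lt (emap a) (fun u => forall v, G u v -> itv lt c d v).
Proof.
move=> dG as_ funG.
pose above v u := forall w, G u w -> lt v w.
pose S v := near_right lt (emap a) (above v).
have dS I (i : I + T) : Mdef (fun e : I -> U => S (lookup iota e i)).
  apply: (@defin_near_right _ a (fun u e => above (lookup iota e i) u)).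
  apply: (defin_all t0 (P := fun w e => G (e None) w ->
    lt (lookup iota (fun j => e (Some j)) i) w)).
  apply: defin_imp.
    pose g b : option (option I) + T := inl (if b then Some None else None).
    exact: (defin_subst g dG).
  case: i => [i|t] /=; first exact: (defin_lt Hlt iota (inl _) (inl _)).
  exact: (defin_lt Hlt iota (inr _) (inl _)).
have dS1 := dS unit (inl tt).
have [l [l1 l2]] : exists l : ext T,
    (forall x, S x -> ~ ext_lt lt (emap l) (Fin x)) /\
    (forall v, ext_lt lt (Fin v) (emap l) -> exists x, S x /\ ~ lt x v).
  have [[|l|] [l1 l2]] := defin_sup Hlt (defin_cst dS1).
  - by exists NInf.
  - pose Q l := (forall x, S x -> ~ lt l x) /\
      (forall v, lt v l -> exists x, S x /\ ~ lt x v).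
    have [||t Qt] := TV (Q := Q); [|by exists l|by exists (Fin t)].
    apply: (defin_and t0).
      apply: (defin_all t0 (P := fun x e => S x -> ~ lt (e tt) x)).
      apply: defin_imp; first exact: (dS _ (inl None)).
      by apply: (defin_not t0); exact: (defin_lt Hlt iota (inl _) (inl _)).
    apply: (defin_all t0 (P := fun v e => lt v (e tt) -> exists x, S x /\ ~ lt x v)).
    apply: defin_imp; first exact: (defin_lt Hlt iota (inl _) (inl _)).
    apply: (defin_ex t0 (P := fun x e => S x /\ ~ lt x (e None))).
    apply: (defin_and t0); first exact: (dS _ (inl None)).
    by apply: (defin_not t0); exact: (defin_lt Hlt iota (inl _) (inl _)).
  - by exists PInf.
exists l => c d cl ld.
have near_s : near_right lt (emap a) (fun u => lt u s).
  by exists s; split=> // x [].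
have lower : near_right lt (emap a) (fun u => forall v, G u v -> ext_lt lt c (Fin v)).
  case: c cl => [|c|] cl.
  - by apply: near_right_imp near_s.
  - case: cl => // /l2 [x [Sx xc]]; apply: near_right_imp Sx => u _ ab w /ab xw.
    exact: (not_ext_lt_trans Hlt (a := Fin c) (b := Fin x) (c := Fin w)).
  - by case: cl => //; case: (l).
have upper : near_right lt (emap a) (fun u => forall v, G u v -> ext_lt lt (Fin v) d).
  case: d ld => [|d|] ld; last by apply: near_right_imp near_s.
    by case: ld => //; case: (l).
  have {ld} [v [lv vd]] : exists v, ext_lt lt (emap l) (Fin v) /\ lt v d.
    by case: ld => // /image_dense [t [? ?]]; exists (iota t).
  have nS : ~ S v by move=> /l1.
  have aoo : ext_lt lt (emap a) PInf by apply: (ext_lt_trans Hlt as_).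
  have dab : Ndef (fun e : unit -> U => above v (e tt)).
    apply: (defin_all s (P := fun w e => G (e tt) w -> lt v w)).
    apply: defin_imp; last exact: (defin_lt Hlt id (inr _) (inl _)).
    pose g b : option unit + U := inl (if b then Some tt else None).
    exact: (defin_subst g (defin_cst dG)).
  case: (near_right_dichotomy Hlt s aoo dab) => // nab.
  apply: near_right_imp (near_right_and Hlt nab near_s) => u au [nabu us] w Guw /=.
  have [v0 Hv0] := funG u (conj au us).
  apply: (not_ext_lt_trans Hlt (a := Fin w) (b := Fin v) (c := Fin d)) => //= vw.
  by apply: nabu => w' /Hv0 ->; move/Hv0: Guw => <-.
apply: near_right_imp (near_right_and Hlt lower upper) => u _ [lo up] v Guv.
by split; [apply: lo|apply: up].
Qed.

(** Near [a] the function [f] turns out to be definable over T, and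
[defin_function_limit] applies. *)
Lemma right_limit_exists a b f (Y : U -> U -> Prop) :
  Ndef (fun e : bool -> U => Y (e true) (e false)) ->
  ext_lt pullback_lt a b ->
  (forall t y, Y (iota t) (iota y) <-> itv pullback_lt a b t /\ y = f t) ->
  exists l, right_limit pullback_lt a b f l.
Proof.
move=> dY ab HY.
pose bpair u v (i : bool) : U := if i then u else v.
have [k [c [D0 [gc dD0 HD0]]]] := defin_generic dY.
pose D u v z := D0 (bpair u v) z.
have HD t y : D (iota t) (iota y) c <-> itv pullback_lt a b t /\ y = f t.
  by rewrite /D -HD0 HY.
have dD I (i j : I + T) h : Mdef (fun e : I -> U => D (lookup iota e i)
    (lookup iota e j) (fun m : 'I_k => lookup iota e (h m))).
  pose g b := if b then i else j.
  by apply: (defin2_app (g := g) (h := h) dD0) => // e [].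
(* [E u v z]: the parameter [z] yields the value [v] at [u], and so do all
   parameters near it *)
pose E u v z := near z (D u v).
have dE I (i j : I + T) h : Mdef (fun e : I -> U => E (lookup iota e i)
    (lookup iota e j) (fun m : 'I_k => lookup iota e (h m))).
  pose g b := if b then i else j.
  apply: (defin_ext (P := fun e => near (fun m => lookup iota e (h m))
      (D0 (fun b => lookup iota e (g b))))); last first.
    exact: (defin2_app (g := g) (h := h) (defin_near dD0)).
  move=> e; rewrite /E /D; set e1 := (fun b : bool => _).
  suff -> : e1 = bpair (lookup iota e i) (lookup iota e j) by [].
  by apply: functional_extensionality; case.
have Ef t v : itv pullback_lt a b t -> (E (iota t) v c <-> v = iota (f t)).
  move=> tab; split=> [Ev|->]; last first.
    have dDt : Mdef (D (iota t) (iota (f t))).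
      exact: (dD _ (inr t) (inr (f t)) (fun m => inl m)).
    by apply/(generic_near gc dDt)/HD.
  (* Another value in U of the relation [E (iota t)] would give one in T. *)
  apply: NNPP => vf.
  have [||y [yf /HD [_ ye]]] := near_tarski_vaught (c := c)
      (D := fun v z => v <> iota (f t) /\ D (iota t) v z).
  - apply: (defin_and t0).
      by apply: (defin_not t0); exact: (defin_eq _ _ (inl None) (inr (f t))).
    exact: (dD _ (inr t) (inl None) (fun m => inl (Some m))).
  - case: Ev => p [q [bc H]]; exists v, p, q; split=> // w bw.
    by split=> //; apply: H.
  - by apply: yf; rewrite ye.
pose func u z := exists v, forall w, E u w z <-> w = v.
have dfunc I (i : I + T) h : Mdef (fun e : I -> U =>
    func (lookup iota e i) (fun m : 'I_k => lookup iota e (h m))).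
  apply: (defin_ex t0 (P := fun v e => forall w,
    E (lookup iota e i) w (fun m => lookup iota e (h m)) <-> w = v)).
  apply: (defin_all t0 (P := fun w e =>
    E (lookup iota (fun x => e (Some x)) i) w
      (fun m => lookup iota (fun x => e (Some x)) (h m)) <-> w = e None)).
  apply: (defin_iff t0); last exact: (defin_eq _ _ (inl None) (inl (Some None))).
  pose up x : option (option I) + T :=
    match x with inl x => inl (Some (Some x)) | inr t => inr t end.
  have upE e x : lookup iota (fun y => e (Some (Some y))) x = lookup iota e (up x).
    by case: x.
  apply: defin_ext (dE _ (up i) (inl None) (fun m => up (h m))) => e.
  rewrite -upE; set z := (fun m : 'I_k => _).
  suff -> : z = (fun m => lookup iota (fun y => e (Some (Some y))) (h m)) by case: (i).
  by apply: functional_extensionality => m; rewrite upE.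
have aoo : ext_lt lt (emap a) PInf.
  by apply/(ext_lt_emap a PInf); case: (a) (b) ab => [|?|] [|?|].
have [s0 [as0 s0b]] : exists s0, itv lt (emap a) (emap b) (iota s0).
  by apply/image_dense/ext_lt_emap.
have itvT s t : ~ lt (iota s0) s -> itv lt (emap a) (Fin s) (iota t) ->
    itv pullback_lt a b t.
  move=> ss0 [at_ ts]; split; first exact/(ext_lt_emap a (Fin t)).
  apply/(ext_lt_emap (Fin t) b); apply: (ext_lt_trans Hlt _ s0b).
  exact: (ext_lt_not_trans Hlt (b := Fin s)).
(* The points of T witness that [func] cannot fail all along to the right of
   [a]. *)
have [r [ar Hr]] : near_right lt (emap a) (fun u => func u c).
  have dfc : Ndef (fun e : unit -> U => func (e tt) c).
    pose h m : unit + 'I_k + T := inl (inr m).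
    pose g x : unit + U := match x with inl tt => inl tt | inr m => inr (c m) end.
    exact: (defin_subst g (defin_cst (dfunc _ (inl (inl tt)) h))).
  case: (near_right_dichotomy Hlt (iota t0) (X := fun u => func u c) aoo dfc) => // -[r [ar Hr]].
  have [s [as_ sr ss0]] := ext_lt_min Hlt ar as0.
  have [t [at_ ts]] := image_dense as_.
  case: (Hr (iota t)); first by split=> //; apply: sr.
  exists (iota (f t)) => w; apply: Ef; apply: (itvT s) => // /ss0.
  exact: (lt_irr Hlt).
have [s1 [as1 s1r s1s0]] := ext_lt_min Hlt ar as0.
have [s [as_ ss1]] := image_dense as1.
have sr : lt (iota s) r by apply: s1r.
have ss0 : ~ lt (iota s0) (iota s).
  by move=> /(lt_trans Hlt (s1s0 _ ss1)); apply: (lt_irr Hlt).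
pose W z := forall u, itv lt (emap a) (Fin (iota s)) u -> func u z.
have dW : Mdef W.
  apply: (defin_all t0 (P := fun u e => itv lt (emap a) (Fin (iota s)) u -> func u e)).
  apply: defin_imp; last exact: (dfunc _ (inl None) (fun m => inl (Some m))).
  apply: (defin_and t0); first exact: (defin_ext_lt a (inl None)).
  exact: (defin_lt Hlt iota (inl None) (inr s)).
have [|p [q [bc HW]]] := gc W dW.
  by move=> u [au us]; apply: Hr; split=> //; apply: (lt_trans Hlt us).
pose B := box lt (iota \o p) (iota \o q).
(* Both [E u v] and its negation are open on the box, which is connected. *)
have const u v z : itv lt (emap a) (Fin (iota s)) u -> B z -> (E u v z <-> E u v c).
  move=> us Bz.
  have step z1 z2 : B z1 -> B z2 -> E u v z1 -> E u v z2; last by split; apply: step.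
  apply: (connected_box Hlt).
    pose h m : bool + 'I_k + T := inl (inr m).
    pose g x : 'I_k + U :=
      match x with inl b => inr (bpair u v b) | inr m => inl m end.
    exact: (defin_subst g (defin_cst (dE _ (inl (inl true)) (inl (inl false)) h))).
  move=> y By; have [w Hw] := HW y By u us.
  have [p' [q' [by' Hb]]] : E u w y by apply/Hw.
  exists p', q'; split=> // y' By' by''.
  have Ey' : E u w y' by exists p', q'.
  have [w' Hw'] := HW y' By' u us.
  by rewrite Hw Hw'; move/Hw': Ey' => ->.
(* The parameter [c] is quantified away, and only the endpoints of the box
   remain. *)
pose G u v := exists z, B z /\ E u v z.
have dG : Mdef (fun e : bool -> U => G (e true) (e false)).
  apply: (defin_ex_tuple t0 (P := fun z e => B z /\ E (e true) (e false) z)).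
  apply: (defin_and t0).
    exact: (defin_box (fun j => inr (p j)) (fun j => inr (q j)) (fun j => inl (inl j))).
  exact: (dE _ (inl (inr true)) (inl (inr false)) (fun m => inl (inl m))).
have GE u v : itv lt (emap a) (Fin (iota s)) u -> (G u v <-> E u v c).
  move=> us; split=> [[z [Bz]]|Ec]; first by rewrite const.
  by exists c.
have [|l Hl] := defin_function_limit dG as_.
  move=> u us; have [v Hv] := HW c bc u us.
  by exists v => w; rewrite GE.
exists l => c0 d0 cl ld.
have [||r' [ar' Hr']] := Hl (emap c0) (emap d0).
- by case: cl => [/ext_lt_emap|->]; [left|right].
- by case: ld => [/ext_lt_emap|->]; [left|right].
have [s' [as' s'r' s's]] := ext_lt_min Hlt ar' as_.
have [u [au us']] := image_dense as'.
exists (Fin u); split; first exact/ext_lt_emap.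
move=> t [/ext_lt_emap at_ /ext_lt_emap tu] tab.
have ts' : lt (iota t) s' by apply: (lt_trans Hlt tu us').
have tus : itv lt (emap a) (Fin (iota s)) (iota t) by split=> //; apply: s's.
have Gt : G (iota t) (iota (f t)) by apply: (proj2 (GE _ _ tus)); apply/Ef.
have [|c0f fd0] := Hr' (iota t) _ _ Gt; first by split=> //; apply: s'r'.
by split; apply/ext_lt_emap.
Qed.

End Generic.

(** * Definable sets of a trace are traces of definable sets *)

Section Trace.
Set Implicit Arguments.
Unset Strict Implicit.
Variables (L : language) (U T : Type) (N : structure L U) (M0 : structure L T).
Variable (iota : T -> U).
Hypothesis elem : elementary_embedding M0 N iota.

Lemma definable_defin k (X : ('I_k -> U) -> Prop) :
  definable N X -> defin N id X.
Proof.
move=> [m [phi [c HX]]].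
pose s (i : 'I_(k + m)) : 'I_k + U :=
  match split i with inl j => inl j | inr j => inr (c j) end.
exists (k + m)%N, phi, s => e; rewrite HX.
suff -> : (fun i => lookup id e (s i)) = fcat e c by [].
by apply: functional_extensionality => i; rewrite /s /fcat; case: split.
Qed.

Lemma defin_definable1 (u0 : U) (X : U -> Prop) :
  defin N id (fun e : unit -> U => X (e tt)) -> definable1 N X.
Proof.
move=> [n [phi [s HX]]].
pose r (i : 'I_n) : 'I_(1 + n) := if s i is inl _ then lshift n ord0 else rshift 1 i.
pose c (i : 'I_n) := if s i is inr u then u else u0.
exists n, (rename phi r), c => x; rewrite sat_rename (HX (fun=> x ord0)).
set a := (fun i => _); set b := (fun i => _); suff -> : a = b by [].
apply: functional_extensionality => i; rewrite /a /b /fcat /r /c.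
case E: (s i) => [j|u]; first by rewrite (unsplitK (inl ord0)).
by rewrite (unsplitK (inr i)) /= E.
Qed.

(** That there is no element is a sentence, false in U and hence in T. *)
Lemma elementary_inhabited (u0 : U) : inhabited T.
Proof.
have [x] : inhabited ('I_0 -> T) by constructor; case.
have : ~ sat N (FAll (FBot L 1)) (iota \o x) by move/(_ u0).
by rewrite -elem => /not_all_ex_not [t _].
Qed.

Lemma elementary_tarski_vaught (t0 : T) : tarski_vaught N iota.
Proof.
move=> Q [n [phi [s HQ]]] [u Qu].
pose r (i : 'I_n) : 'I_n.+1 := if s i is inl _ then ord0 else lift ord0 i.
pose x (i : 'I_n) := if s i is inr t then t else t0.
have HQ' v : Q v <-> sat N (rename phi r) (fcons v (iota \o x)).
  rewrite sat_rename (HQ (fun=> v)).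
  set a := (fun i => _); set b := (fun i => _); suff -> : a = b by [].
  apply: functional_extensionality => i; rewrite /a /b /r /x.
  by case E: (s i) => [j|t]; rewrite ?fcons0 ?fcons_lift //= E.
have : ~ sat N (FAll (FImp (rename phi r) (FBot L _))) (iota \o x).
  by move=> /(_ u); apply; apply/HQ'.
rewrite -elem => /not_all_ex_not [t /= Ht].
exists t; apply/HQ'.
have -> : fcons (iota t) (iota \o x) = iota \o fcons t x.
  by apply: functional_extensionality => i; rewrite /= -(fcons_map iota).
by apply/elem; apply: NNPP.
Qed.

(** Apply elementarity to the formula that equates a new variable with [t]. *)
Lemma eval_embedding n (t : term L n) (x : 'I_n -> T) :
  eval N (iota \o x) t = iota (eval M0 x t).
Proof.
pose phi := FEq (Var L ord0) (term_rename (fun i => lift ord0 i) t).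
have xE (A : Type) (y : 'I_n -> A) a : (fun i => fcons a y (lift ord0 i)) = y.
  by apply: functional_extensionality => i; rewrite fcons_lift.
have /elem /= : sat M0 phi (fcons (eval M0 x t) x).
  by rewrite /= eval_rename fcons0 xE.
rewrite eval_rename fcons0 => ->; congr (eval N _ t).
by apply: functional_extensionality => i; rewrite /= fcons_lift.
Qed.

Fixpoint term_reduct n (t : term (trace_language N) n) : term L n :=
  match t with
  | Var i => Var L i
  | App k f ts => @App L n k f (fun j => term_reduct (ts j))
  end.

Lemma eval_reduct n (t : term (trace_language N) n) (x : 'I_n -> T) :
  eval (induced_structure M0 N iota) x t = eval M0 x (term_reduct t).
Proof.
elim: t => [//|k f ts IH] /=; congr (fint M0 f _).
exact: functional_extensionality.
Qed.

Lemma defin_eval I n (t : term L n) (i : I) (s : 'I_n -> I) :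
  defin N id (fun e : I -> U => e i = eval N (fun j => e (s j)) t).
Proof.
exists n.+1, (FEq (Var L ord0) (term_rename (fun i => lift ord0 i) t)).
exists (fcons (inl i) (fun j => inl (s j))) => e /=.
rewrite eval_rename fcons0 /=.
suff -> : (fun j => lookup id e (fcons (inl i) (fun j => inl (s j)) (lift ord0 j)))
  = (fun j => e (s j)) by [].
by apply: functional_extensionality => j; rewrite fcons_lift.
Qed.

Variable lt : U -> U -> Prop.
Hypothesis Hlt : omin_order N lt.
Hypothesis dense : dense_image iota lt.
Variable t0 : T.

(** The only step of the induction that is not formal is the quantifier, which
ranges over T and not over U; it is [trace_projection]. *)
Lemma induced_quantifier_elimination n (phi : formula (trace_language N) n) :
  exists X : ('I_n -> U) -> Prop, defin N id X /\
    forall x, sat (induced_structure M0 N iota) phi x <-> X (iota \o x).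
Proof.
elim: n / phi => [n|n s t|n k R ts|n p [X [dX HX]] q [Y [dY HY]]|n p [X [dX HX]]].
- by exists (fun=> False); split=> //; apply: (defin_bot _ _ (iota t0)).
- exists (fun e => eval N e (term_reduct s) = eval N e (term_reduct t)); split.
    by exists n, (FEq (term_reduct s) (term_reduct t)), (fun i => inl i).
  move=> x /=; rewrite -[X in _ <-> X]/(sat N (FEq _ _) (iota \o x)) -elem /=.
  by rewrite !eval_reduct.
- case: R => [R|D].
    pose psi := FRel R (fun j => term_reduct (ts j)).
    exists (sat N psi); split; first by exists n, psi, (fun i => inl i).
    move=> x; rewrite -elem /=.
    suff -> : (fun j => eval (induced_structure M0 N iota) x (ts j)) =
      (fun j => eval M0 x (term_reduct (ts j))) by [].
    by apply: functional_extensionality => j; rewrite eval_reduct.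
  exists (fun e => sval D (fun j => eval N e (term_reduct (ts j)))); split.
    apply: (defin_ext (P := fun e => exists y,
      (forall j, y j = eval N e (term_reduct (ts j))) /\ sval D y)).
      move=> e; split=> [[y [yE Dy]]|De]; last by eexists; split; last exact: De.
      suff <- : y = (fun j => eval N e (term_reduct (ts j))) by [].
      exact: functional_extensionality.
    apply: (defin_ex_tuple (iota t0) (P := fun y e =>
      (forall j, y j = eval N e (term_reduct (ts j))) /\ sval D y)).
    apply: (defin_and (iota t0)).
      by apply: (defin_forall_ord (iota t0)) => j; apply: defin_eval.
    pose g (j : 'I_k) : 'I_k + 'I_n + U := inl (inl j).
    exact: (defin_subst g (definable_defin (svalP D))).
  move=> x /=.
  suff -> : (fun j => eval N (iota \o x) (term_reduct (ts j))) =
     iota \o (fun j => eval (induced_structure M0 N iota) x (ts j)) by [].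
  by apply: functional_extensionality => j; rewrite /= eval_reduct eval_embedding.
- exists (fun e => X e -> Y e); split; first exact: defin_imp.
  by move=> x /=; rewrite HX HY.
- have [Y [dY HY]] := trace_projection Hlt (elementary_tarski_vaught t0) dense t0
    (defin_not (iota t0) (defin_fcons dX)).
  exists (fun e => ~ Y e); split; first exact: (defin_not (iota t0)).
  move=> x /=; rewrite -HY /=; split=> [H [t]|H t].
    apply; have /HX := H t.
    suff -> : iota \o fcons t x = fcons (iota t) (iota \o x) by [].
    by apply: functional_extensionality => i; rewrite /= -(fcons_map iota).
  apply: NNPP => nH; apply: H; exists t => Xt; apply/nH/HX.
  suff -> : iota \o fcons t x = fcons (iota t) (iota \o x) by [].
  by apply: functional_extensionality => i; rewrite /= -(fcons_map iota).
Qed.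

End Trace.

(** * Limits in o-minimal traces *)

Section Limits.
Set Implicit Arguments.
Unset Strict Implicit.

(** The difference of [u] and [v] gives a positive element; translating by it and
by its inverse moves any point up and down. *)
Lemma ordered_group_unbounded U (lt : U -> U -> Prop) (add : U -> U -> U)
    (u v : U) :
  ordered_group lt add -> u <> v ->
  (forall x, exists y, lt y x) /\ (forall x, exists y, lt x y).
Proof.
move=> [[_ _ tot] _ [zero [add0 inv]] mono] uv.
have [g g0] : exists g, lt zero g.
  suff pos a b : lt a b -> exists g, lt zero g.
    by case: (tot u v) => [/pos|/uv|/pos].
  move=> ab; have [a' [_ a'a]] := inv a; exists (add a' b); rewrite -a'a.
  by have [] := mono _ _ a' ab.
have [h [_ hg]] := inv g.
have h0 : lt h zero.
  by have [+ _] := mono _ _ h g0; rewrite hg (proj2 (add0 h)).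
split=> x.
  by exists (add x h); have [+ _] := mono _ _ x h0; rewrite (proj2 (add0 x)).
by exists (add x g); have [+ _] := mono _ _ x g0; rewrite (proj2 (add0 x)).
Qed.

Lemma right_limit_flip T (lt : T -> T -> Prop) a b f l :
  right_limit (flip lt) (eflip b) (eflip a) f l -> left_limit lt a b f (eflip l).
Proof.
move=> H c d cl ld.
have [||u [bu Hu]] := H (eflip d) (eflip c).
- by case: ld => [ld|->]; [left; rewrite -[l]eflipK; apply/ext_lt_flip|right].
- by case: cl => [cl|->]; [left; rewrite -[l]eflipK; apply/ext_lt_flip|right].
exists (eflip u); split; first by apply/ext_lt_flip; rewrite eflipK.
move=> t tu tab; apply/itv_flip/Hu; last exact/itv_flip.
by rewrite -[u]eflipK; apply/itv_flip.
Qed.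

Lemma o_minimal_omin_order (L : olanguage) U (N : structure L U) (u v : U) :
  o_minimal N -> expands_ordered_group N -> u <> v -> omin_order N (slt N).
Proof.
move=> [dlo sets] [add grp] uv.
have [below above] := ordered_group_unbounded grp uv; split=> //.
- by exists (FRel (lt_sym L) (fun j => Var L j)).
- by move=> X /(defin_definable1 u) /sets.
Qed.

Lemma definable2_trace (L L0 : language) T U (M : structure L T)
    (M0 : structure L0 T) (N : structure L0 U) iota lt (t0 : T) :
  elementary_embedding M0 N iota -> omin_order N lt -> dense_image iota lt ->
  interdefinable M (induced_structure M0 N iota) ->
  forall R : T -> T -> Prop, definable2 M R ->
  exists Y : U -> U -> Prop,
    defin N id (fun e : bool -> U => Y (e true) (e false)) /\
    forall x y, Y (iota x) (iota y) <-> R x y.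
Proof.
move=> elem Hlt dense inter R [k [phi [c HR]]].
have [psi Hpsi] : definable0 (induced_structure M0 N iota) (sat M phi).
  by apply/inter; exists phi.
have [X [dX HX]] := induced_quantifier_elimination elem Hlt dense t0 psi.
exists (fun u v => X (fcat (pair2 u v) (iota \o c))); split.
  pose g := fcat (pair2 (inl true) (inl false)) (fun j => inr (iota (c j)))
    : 'I_(2 + k) -> bool + U.
  apply: (defin_app (g := g) dX) => e i; rewrite /g /fcat.
  by case: split => j //=; rewrite /pair2; case: (j == ord0).
move=> x y; rewrite -[R x y]/(R (pair2 x y ord0) (pair2 x y ord_max)).
rewrite (HR (pair2 x y)) Hpsi HX.
suff -> : fcat (pair2 (iota x) (iota y)) (iota \o c) = iota \o fcat (pair2 x y) c by [].
apply: functional_extensionality => i; rewrite /= /fcat.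
by case: split => j //=; rewrite /pair2; case: (j == ord0).
Qed.

End Limits.

Theorem proposition2 (L : olanguage) (T : Type) (M : structure L T) :
  o_minimal_trace M -> no_external_limits M.
Proof.
move=> [L0 [U [N [M0 [iota [[omin grp] elem [u0 Hu0] dense [ltM inter]]]]]]] a b f ab df.
have [t0] := elementary_inhabited elem u0.
have Hlt := o_minimal_omin_order omin grp (Hu0 t0).
have ltE : slt M = pullback_lt iota (slt N).
  apply: functional_extensionality => x; apply: functional_extensionality => y.
  apply: propositional_extensionality.
  have := elem _ (FRel (lt_sym L0) (fun j => Var L0 j)) (pair2 x y).
  rewrite ltM /pullback_lt /slt /=.
  suff -> : (fun j => iota (pair2 x y j)) = pair2 (iota x) (iota y) by [].
  by apply: functional_extensionality => i; rewrite /pair2; case: (i == ord0).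
have [Y [dY HY]] := definable2_trace t0 elem Hlt dense inter df.
have TV := elementary_tarski_vaught elem t0.
split; first by rewrite ltE in ab HY *; apply: (right_limit_exists Hlt TV dense t0 dY).
have denseF : dense_image iota (flip (slt N)).
  by move=> u v /dense [t [? ?]]; exists t.
have [||l Hl] := right_limit_exists (omin_order_flip Hlt) TV denseF t0
    (a := eflip b) (b := eflip a) (f := f) dY.
- by move: ab; rewrite ltE; case: (a) (b) => [|x|] [|y|].
- by move=> t y; rewrite HY ltE -itv_flip.
by exists (eflip l); apply: right_limit_flip; rewrite ltE.
Qed.
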